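(* There exist $c>0$ and $n_0\ge 2$ for which the following holds. For all integers $n\ge n_0$ and $1\le d\le cn/\log^2 n$, every $n$-vertex graph $G$ with minimum degree $\delta(G)\ge d$ has pseudoachromatic number $\psi_s(G)\ge d+1$.
   Context: Graphs are finite and simple; $\log$ is the natural logarithm and $\log^2 n=(\log n)^2$. A pseudocomplete colouring of a graph is a colouring of its vertices, not necessarily proper, such that each pair of distinct colours appears together on at least one edge; equivalently, it is a partition of the vertex set (into nonempty parts) in which every two distinct parts are connected by at least one edge. The pseudoachromatic number $\psi_s(G)$ is the maximum number of colours in a pseudocomplete colouring of $G$. *)

(* Defs.v *)
From mathcomp Require Import all_boot.

Set Implicit Arguments.
Unset Strict Implicit.
Unset Printing Implicit Defensive.

(* A graph with vertex set V is given by its adjacency relation e : rel V;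
   simplicity is the pair of hypotheses symmetric e, irreflexive e. *)

Definition degree (V : finType) (e : rel V) (v : V) : nat :=
  #|[set w | e v w]|.

(* The neutral value #|V| exceeds every degree of a simple graph, so it only
   matters when V is empty. *)
Definition min_degree (V : finType) (e : rel V) : nat :=
  \big[minn/#|V|]_(v : V) degree e v.

(* The first condition says that all k colours are used. It follows from the
   second one for k >= 2, but not for k = 1 and V empty. *)
Definition pseudocomplete_colouring (V : finType) (e : rel V) (k : nat)
    (f : {ffun V -> 'I_k}) : bool :=
  [forall i : 'I_k, exists v : V, f v == i] &&
  [forall i : 'I_k, forall j : 'I_k, (i != j) ==>
     [exists u : V, exists v : V, [&& e u v, f u == i & f v == j]]].

(* The bound k <= #|V| only makes the range finite: see
   leq_pseudoachromatic_number. *)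
Definition pseudoachromatic_number (V : finType) (e : rel V) : nat :=
  \max_(k < #|V|.+1 |
        [exists f : {ffun V -> 'I_k}, pseudocomplete_colouring e f]) k.

Lemma leq_pseudoachromatic_number (V : finType) (e : rel V) (k : nat)
    (f : {ffun V -> 'I_k}) :
  pseudocomplete_colouring e f -> k <= pseudoachromatic_number e.
Proof.
move=> fP; have kV : k < #|V|.+1.
  have /andP[/forallP surj _] := fP; rewrite ltnS.
  have sub : [set: 'I_k] \subset f @: [set: V].
    apply/subsetP => i _; have /existsP[v /eqP <-] := surj i.
    exact: imset_f.
  have := leq_trans (subset_leq_card sub) (leq_imset_card f [set: V]).
  by rewrite !cardsT card_ord.
apply: (@leq_bigmax_cond _ _ (fun i : 'I_#|V|.+1 => i : nat) (Ordinal kV)).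
by apply/existsP; exists f.
Qed.

Lemma pseudoachromatic_number_attained (V : finType) (e : rel V) (v0 : V) :
  exists f : {ffun V -> 'I_(pseudoachromatic_number e)},
    pseudocomplete_colouring e f.
Proof.
pose P (k : 'I_#|V|.+1) :=
  [exists f : {ffun V -> 'I_k}, pseudocomplete_colouring e f].
have V1 : 1 < #|V|.+1 by rewrite ltnS; apply/card_gt0P; exists v0.
have P1 : 0 < #|P|.
  apply/card_gt0P; exists (Ordinal V1); apply/existsP.
  exists [ffun => ord0 : 'I_1]; apply/andP; split.
    by apply/forallP => i; apply/existsP; exists v0; rewrite ffunE ord1.
  by apply/forallP => i; apply/forallP => j; rewrite !ord1 eqxx.
have [k kP kE] := eq_bigmax_cond (fun k : 'I_#|V|.+1 => k : nat) P1.
have -> : pseudoachromatic_number e = k by rewrite -kE.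
by apply/existsP.
Qed.

(* Main.v *)
Require Import Defs.
From mathcomp Require Import all_boot all_order all_algebra.
From mathcomp Require Import reals exp.
From mathcomp Require Import sequences ring lra.

Set Implicit Arguments.
Unset Strict Implicit.
Unset Printing Implicit Defensive.

(* High-degree vertices, at most d of them, receive their own colours; every
   other vertex gets a random colour, half of the time uniform among all d + 1
   colours and half of the time uniform among the k colours not yet owned. A
   vertex of degree at least 16 d ln n then sees every colour. If fewer than d
   vertices have high degree, the remaining graph has minimum degree at least
   k - 1 and maximum degree O(d ln n). Split it by a maximum cut into A and B,
   every vertex of the larger side B keeping t >= (k - 1) / 2 neighbours in A.
   Colour A first: for each new colour i, the set of vertices of B with a
   kept neighbour coloured i is so large that a second random new colour j
   misses it with probability at most n^-3. The method of conditional
   expectations, applied to an explicit supermartingale, replaces the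
   probability space. *)

Import Order.TTheory GRing.Theory Num.Theory.

(** * Subsets of prescribed size and maximum cuts *)

Lemma exists_subset_card (V : finType) (A : {set V}) (k : nat) :
  (k <= #|A|)%N -> exists2 B : {set V}, B \subset A & #|B| = k.
Proof.
move=> kA; exists [set x in take k (enum A)].
  by apply/subsetP => x; rewrite inE => /mem_take; rewrite mem_enum.
rewrite cardsE (card_uniqP _) ?take_uniq ?enum_uniq //.
by rewrite size_takel // -cardE.
Qed.

Definition flip (V : finType) (s : {ffun V -> bool}) (x : V) :=
  [ffun y => if y == x then ~~ s x else s y].

(** Take [s] with the fewest monochromatic edges inside [W]. Flipping [x] swaps its like and unlike
    neighbours and affects no other edge, so minimality gives the inequality. *)
Lemma max_cut (V : finType) (e : rel V) (W : {set V}) :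
  symmetric e -> irreflexive e ->
  exists s : {ffun V -> bool}, forall x, x \in W ->
    (#|[set w in W | e x w & s w == s x]|
      <= #|[set w in W | e x w & s w != s x]|)%N.
Proof.
move=> eC eI; pose F (s : {ffun V -> bool}) u v : nat := e u v && (s v == s u).
(* Ordered pairs are counted, so the edges at [x] enter once as a row and once as a column: the
   factor 2 in [mE]. *)
pose m s := (\sum_(u in W) \sum_(v in W) F s u v)%N.
case: (@arg_minnP _ [ffun=> true] predT m isT) => s _ smin; exists s => x xW.
pose rest s := (\sum_(u in W | u != x) \sum_(v in W | v != x) F s u v)%N.
have mE s' : m s' = (2 * (\sum_(v in W | v != x) F s' x v) + rest s')%N.
  have Fx : F s' x x = 0%N by rewrite /F eI.
  rewrite /m (bigD1 x) //= (bigD1 x) //= Fx add0n mul2n -addnn -addnA.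
  congr addn; rewrite -big_split /=; apply: eq_bigr => u /andP[uW ux].
  rewrite (bigD1 x) //=; congr addn.
  by rewrite /F eC eq_sym.
have restE : rest (flip s x) = rest s.
  apply: eq_bigr => u /andP[_ /negPf ux]; apply: eq_bigr => v /andP[_ /negPf vx].
  by rewrite /F !ffunE ux vx.
have := smin (flip s x) isT; rewrite !mE restE leq_add2r leq_pmul2l //.
have -> : (\sum_(v in W | v != x) F s x v
            = #|[set w in W | e x w & s w == s x]|)%N.
  rewrite -sum1_card big_mkcond [RHS]big_mkcond /=; apply: eq_bigr => v _.
  rewrite !inE /F; case: (altP (v =P x)) => [->|_]; first by rewrite eI ?andbF.
  by rewrite andbT; case: (v \in W); case: (e x v && _).
have -> // : (\sum_(v in W | v != x) F (flip s x) x v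
            = #|[set w in W | e x w & s w != s x]|)%N.
rewrite -sum1_card big_mkcond [RHS]big_mkcond /=; apply: eq_bigr => v _.
rewrite !inE /F !ffunE eqxx; case: (altP (v =P x)) => [->|vx].
  by rewrite eI ?andbF.
rewrite andbT; case: (v \in W); case: (e x v) => //=.
by case: (s v); case: (s x).
Qed.

(** [A] is the smaller side of a maximum cut, so that [W :\: A] keeps at least half of [W] and each
    of its vertices has at least half of its [W]-neighbours across. *)
Lemma majority_cut (V : finType) (e : rel V) (W : {set V}) :
  symmetric e -> irreflexive e ->
  exists A : {set V}, [/\ A \subset W, (#|W| <= 2 * #|W :\: A|)%N &
    forall v, v \in W :\: A ->
      (#|[set w in W | e v w]| <= 2 * #|[set w in A | e v w]|)%N].
Proof.
move=> eC eI; have [s sP] := max_cut W eC eI.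
pose A b := [set v in W | s v != b].
have [b bP] : exists b, (#|W| <= 2 * #|W :\: A b|)%N.
  have WE : (#|W| = #|W :\: A true| + #|W :\: A false|)%N.
    rewrite -(cardsID (A false) W); congr addn; apply: eq_card => v;
      by rewrite !inE; case: (s v); case: (v \in W).
  case: (leqP #|W :\: A true| #|W :\: A false|) => [le|/ltnW le];
    [exists false | exists true]; rewrite WE mul2n -addnn.
    by rewrite leq_add2r.
  by rewrite leq_add2l.
exists (A b); split=> // [|v].
  by apply/subsetP => v; rewrite inE => /andP[].
rewrite !inE => /andP[+ vW]; rewrite vW /= negbK => /eqP svb.
have := sP _ vW; rewrite svb => le.
rewrite -(cardsID [set w | s w == b]) mul2n -addnn leq_add //.
  apply: leq_trans (leq_trans le _).
    by apply/subset_leq_card/subsetP => w; rewrite !inE -andbA.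
  by apply/subset_leq_card/subsetP => w; rewrite !inE => /and3P[-> -> ->].
apply/subset_leq_card/subsetP => w; rewrite !inE.
by case/and3P => -> -> ->.
Qed.

Local Open Scope ring_scope.

(** * Partial colourings and the method of conditional expectations *)

Definition update (V C : finType) (f : {ffun V -> option C}) (u : V) (c : C) :
  {ffun V -> option C} := [ffun x => if x == u then Some c else f x].

(** Some colour does at least as well as the [P]-average, so the uncoloured vertices of [A] can be
    treated one by one without raising [Phi]. All other values are preserved, which allows several
    phases to be chained. *)
Lemma derandomize (R : realDomainType) (V C : finType) (P : C -> R)
    (Phi : {ffun V -> option C} -> R) (A : {set V}) :
  (forall c, 0 <= P c) -> \sum_c P c = 1 ->
  (forall (f : {ffun V -> option C}) u, u \in A -> f u = None ->
     \sum_c P c * Phi (update f u c) <= Phi f) ->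
  forall f : {ffun V -> option C}, exists g : {ffun V -> option C},
    [/\ forall u, u \in A -> g u != None,
        forall u, (u \notin A) || (f u != None) -> g u = f u & Phi g <= Phi f].
Proof.
move=> P0 P1 step f.
have [m] := ubnP #|[set u in A | f u == None]|; elim: m f => // m IH f fm.
have [|none] := boolP [exists u in A, f u == None]; last first.
  exists f; split=> // u uA; apply: contra none => fu.
  by apply/existsP; exists u; rewrite uA.
case/existsP => u /andP[uA /eqP fu].
have [c cP] : exists c, Phi (update f u c) <= Phi f.
  (* If every colour raised [Phi], the nonnegative terms of [sum0] would all vanish, forcing [P] to
     be zero against its total mass 1. *)
  apply/existsP; apply: contraT; rewrite negb_exists => /forallP gt.
  have term0 c : 0 <= P c * (Phi (update f u c) - Phi f).
    by rewrite mulr_ge0 // subr_ge0 ltW // ltNge gt.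
  have sum0 : \sum_c P c * (Phi (update f u c) - Phi f) = 0.
    apply/le_anti; rewrite sumr_ge0 // andbT.
    under eq_bigr do rewrite mulrBr.
    by rewrite sumrB -mulr_suml P1 mul1r subr_le0 step.
  have Pc0 c : P c = 0.
    have := psumr_eq0P (fun c _ => term0 c) sum0 (i := c) isT.
    move/eqP; rewrite mulf_eq0 subr_eq0 => /orP[/eqP //|/eqP E].
    by have := gt c; rewrite E lexx.
  by move: P1; rewrite big1 // => /eqP; rewrite eq_sym oner_eq0.
have [|g [g1 g2 g3]] := IH (update f u c).
  rewrite -ltnS; apply: leq_trans fm; rewrite ltnS; apply: proper_card.
  apply/properP; split.
    by apply/subsetP => x; rewrite !inE ffunE; case: ifP; rewrite ?andbF.
  by exists u; rewrite !inE ?uA ?fu ?ffunE ?eqxx.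
exists g; split=> // [x xf|]; last exact: le_trans cP.
have xu : x != u by apply: contraTneq xf => ->; rewrite uA fu.
by rewrite g2 ffunE (negPf xu).
Qed.

(* Conditional probability bound that no vertex of [S] receives colour [c],
   given the partial colouring [f] and that each uncoloured vertex gets [c]
   with probability at least [p]. *)
Definition miss_potential (R : realDomainType) (V C : finType) (p : R)
    (S : {set V}) (c : C) (f : {ffun V -> option C}) : R :=
  if [exists u in S, f u == Some c] then 0
  else (1 - p) ^+ #|[set u in S | f u == None]|.

Lemma miss_potential_ge0 (R : realDomainType) (V C : finType) (p : R)
    (S : {set V}) (c : C) (f : {ffun V -> option C}) :
  p <= 1 -> 0 <= miss_potential p S c f.
Proof.
by move=> p1; rewrite /miss_potential; case: ifP => // _; rewrite exprn_ge0 // subr_ge0.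
Qed.

(** For [u] in an unhit [S], colour [c] makes the potential 0 and the others, of total weight
    [1 - P c <= 1 - p], remove one factor [1 - p]. If [S] is hit or [u] lies outside [S], the
    potential stays constant. *)
Lemma miss_potential_step (R : realDomainType) (V C : finType) (P : C -> R)
    (p : R) (S : {set V}) (c : C) (f : {ffun V -> option C}) (u : V) :
  (forall c, 0 <= P c) -> \sum_c P c = 1 -> p <= P c -> f u = None ->
  \sum_c' P c' * miss_potential p S c (update f u c') <= miss_potential p S c f.
Proof.
move=> P0 P1 pP fu.
have P_le1 : P c <= 1.
  by rewrite -P1 (bigD1 c) //= lerDl; apply: sumr_ge0.
have q0 : 0 <= 1 - p by rewrite subr_ge0 (le_trans pP).
have [hit|miss] := boolP [exists u in S, f u == Some c].
  rewrite big1 => [|c' _]; first by rewrite miss_potential_ge0 // (le_trans pP).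
  rewrite /miss_potential ifT ?mulr0 //.
  have /existsP[v /andP[vS /eqP fv]] := hit.
  apply/existsP; exists v; rewrite vS ffunE fv.
  by case: (v =P u) => [vu|_]; [move: fv; rewrite vu fu|rewrite eqxx].
rewrite [leRHS]/miss_potential (negPf miss).
have missP v : v \in S -> f v == Some c = false.
  by move=> vS; apply: contraNF miss => fv; apply/existsP; exists v; rewrite vS.
have [uS|uS] := boolP (u \in S); last first.
  rewrite (eq_bigr (fun c' => P c' * (1 - p) ^+ #|[set u in S | f u == None]|)).
    by rewrite -mulr_suml P1 mul1r.
  move=> c' _; congr (_ * _); rewrite /miss_potential ifF.
    congr (_ ^+ _); apply: eq_card => v; rewrite !inE ffunE.
    by case: (v =P u) => [->|//]; rewrite (negPf uS).
  apply/existsP => -[v /andP[vS]]; rewrite ffunE.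
  by case: (v =P u) => [vu _|_]; [move: uS; rewrite -vu vS|rewrite missP].
rewrite (cardsD1 u) !inE uS fu eqxx exprS.
set m := #|_|.
have mE c' : c' != c ->
    miss_potential p S c (update f u c') = (1 - p) ^+ m.
  move=> c'c; rewrite /miss_potential ifF.
    congr (_ ^+ _); apply: eq_card => v; rewrite !inE ffunE.
    by case: (v =P u) => [->|_]; rewrite ?andbF.
  apply/existsP => -[v /andP[vS]]; rewrite ffunE.
  case: (v =P u) => [_|_]; last by rewrite missP.
  by case/eqP => E; rewrite E eqxx in c'c.
rewrite (bigD1 c) //= [miss_potential _ _ _ (update f u c)]ifT; last first.
  by apply/existsP; exists u; rewrite uS ffunE !eqxx.
rewrite mulr0 add0r (eq_bigr (fun c' => P c' * (1 - p) ^+ m)); last first.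
  by move=> c' /mE ->.
rewrite -mulr_suml ler_wpM2r ?exprn_ge0 //.
by move: P1; rewrite (bigD1 c) //= => <-; rewrite [P c + _]addrC -addrA lerDl subr_ge0.
Qed.

(** * Exponential inequalities for a single colouring step *)

Lemma expr_le_expR (R : realType) (p : R) (n : nat) :
  p <= 1 -> (1 - p) ^+ n <= expR (- (p * n%:R)).
Proof.
move=> p1; rewrite -mulNr expRM_natr lerXn2r ?nnegrE ?expR_ge0 ?subr_ge0 //.
exact: expR_ge1Dx.
Qed.

(* Comes from [1 - expR (- y) >= y / (1 + y)] at [y = p * g / 2], [g <= D]. *)
Definition cover_rate (R : realFieldType) (p D : R) : R := p ^+ 2 / (2 + p * D).

(** With probability [P] the step covers [g] vertices but forfeits their [s] pending chances;
    otherwise only [g] chances are lost. The rate is small enough that on average the potential does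
    not grow. *)
Lemma cover_balance (R : realType) (p P D : R) (t g s : nat) :
  0 < p -> p <= P -> P <= 1 -> g%:R <= D -> cover_rate p D * t%:R <= p / 2 ->
  (s <= t * g)%N ->
  (1 - P) * expR (cover_rate p D * g%:R)
    + P * ((1 - p) ^+ g * expR (cover_rate p D * s%:R)) <= 1.
Proof.
move=> p0 pP P1 gD bt sg; have g0 : 0 <= g%:R :> R by [].
have D0 : 0 <= D by apply: le_trans gD.
have pD0 : 0 <= p * D by rewrite mulr_ge0 // ltW.
have bE : cover_rate p D * (2 + p * D) = p ^+ 2.
  by rewrite /cover_rate divfK //; apply: lt0r_neq0; lra.
set b := cover_rate p D in bt bE *.
have b0 : 0 <= b by rewrite divr_ge0 ?exprn_ge0 //; lra.
pose y := p * g%:R / 2; have y0 : 0 <= y by rewrite divr_ge0 ?mulr_ge0 // ltW.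
pose X := expR (- y).
have XE : X * (1 + y) <= 1.
  rewrite /X expRN mulrC ler_pdivrMr ?expR_gt0 // mul1r; exact: expR_ge1Dx.
(* The forfeited chances cost at most [p * g / 2], half of the gain [p * g] in the exponent. *)
have second : (1 - p) ^+ g * expR (b * s%:R) <= X.
  apply: (@le_trans _ _ (expR (- (p * g%:R)) * expR (p / 2 * g%:R))).
    rewrite ler_pM ?expR_ge0 ?exprn_ge0 ?expr_le_expR //; try lra.
    rewrite ler_expR (@le_trans _ _ (b * (t%:R * g%:R))) //.
      by rewrite ler_wpM2l // -natrM ler_nat.
    by rewrite mulrA ler_wpM2r.
  by rewrite -expRD ler_expR /y; lra.
have X0 : 0 <= X by apply: expR_ge0.
have X1 : X <= 1 by rewrite /X -expR0 ler_expR; lra.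
have bg : b * g%:R <= p * (1 - X).
  have h1 : p * y <= p * (1 - X) * (1 + y) by rewrite -mulrA ler_wpM2l ?(ltW p0) //; lra.
  have h2 : b * g%:R * (1 + y) <= p * y.
    have : b * (2 + p * g%:R) <= p ^+ 2.
      by rewrite -bE ler_wpM2l // lerD2l ler_wpM2l // ltW.
    by move=> h; rewrite /y; nra.
  by rewrite -(@ler_pM2r _ (1 + y)) ?(le_trans h2) //; lra.
(* Enlarging the second term by [expR (b * g%:R) >= 1] gives a common factor; then [P] may be
   lowered to [p] because [X <= 1]. *)
apply: (@le_trans _ _ (expR (b * g%:R) * (1 - p * (1 - X)))).
  have E1 : 1 <= expR (b * g%:R).
    by rewrite leNgt expR_lt1 -leNgt mulr_ge0.
  have : P * ((1 - p) ^+ g * expR (b * s%:R)) <= P * X by rewrite ler_wpM2l //; lra.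
  set E := expR _ in E1 *; set Y := P * (_ * _); move=> hY.
  have : P * X <= E * (P * X) by rewrite ler_peMl // mulr_ge0 //; lra.
  have : p * (1 - X) * E <= P * (1 - X) * E by rewrite ler_wpM2r ?ler_wpM2r //; lra.
  lra.
have : 1 - p * (1 - X) <= expR (- (b * g%:R)).
  apply: (le_trans _ (expR_ge1Dx _)); lra.
by rewrite -(ler_pM2l (expR_gt0 (b * g%:R))) expRxMexpNx_1.
Qed.

(** * The potential controlling how many vertices of [B] see a given colour *)

Section CoverPotential.
Variables (R : realType) (V C : finType) (p b : R) (B : {set V}).
Variables (T : V -> {set V}) (c : C).

Definition covered (f : {ffun V -> option C}) : {set V} :=
  [set v in B | [exists u in T v, f u == Some c]].

Definition pending (f : {ffun V -> option C}) (v : V) : nat :=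
  #|[set u in T v | f u == None]|.

(* Conditional expectation bound for [(1 - p) ^ #|covered|] over the random
   completion of [f]: each uncovered vertex gains the factor [expR (- b)] for
   each of its chances of being covered later. *)
Definition cover_potential (f : {ffun V -> option C}) : R :=
  (1 - p) ^+ #|covered f| *
  expR (- (b * (\sum_(v in B :\: covered f) pending f v)%:R)).
End CoverPotential.

Section CoverStep.
Variables (R : realType) (V C : finType) (P : C -> R) (p D : R) (B : {set V}).
Variables (T : V -> {set V}) (t : nat) (c : C).
Hypotheses (P_ge0 : forall c, 0 <= P c) (P_sum1 : \sum_c P c = 1).
Hypotheses (p_gt0 : 0 < p) (pP : p <= P c).
Hypotheses (T_card : forall v, v \in B -> (#|T v| <= t)%N).
Hypotheses (T_degree : forall u, #|[set v in B | u \in T v]|%:R <= D).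
Hypothesis rate_le : cover_rate p D * t%:R <= p / 2.

(** Only the uncovered vertices [G] with [u] among their kept neighbours are affected. Both outcomes
    multiply the potential by an explicit factor, and [cover_balance] with [g = #|G|] bounds the
    mean factor by 1. *)
Lemma cover_potential_step (f : {ffun V -> option C}) (u : V) : f u = None ->
  \sum_c' P c' * cover_potential p (cover_rate p D) B T c (update f u c')
    <= cover_potential p (cover_rate p D) B T c f.
Proof.
move=> fu; set b := cover_rate p D.
have P_le1 : P c <= 1.
  by rewrite -P_sum1 (bigD1 c) //= lerDl; apply: sumr_ge0.
have covP g v : (v \in covered B T c g) = (v \in B) && [exists u in T v, g u == Some c].
  by rewrite inE.
pose U := B :\: covered B T c f.
pose G := [set v in U | u \in T v].
have GP v : (v \in G) = [&& v \notin covered B T c f, v \in B & u \in T v].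
  by rewrite in_set in_setD andbA.
pose s := (\sum_(v in G) pending T f v)%N.
pose S := (\sum_(v in U) pending T f v)%N.
(* A colour other than [c] covers nothing new and costs each vertex of [G] one pending chance. *)
have miss c' : c' != c ->
    cover_potential p b B T c (update f u c')
      = (1 - p) ^+ #|covered B T c f| * expR (- (b * S%:R)) * expR (b * #|G|%:R).
  move=> c'c; rewrite /cover_potential.
  have -> : covered B T c (update f u c') = covered B T c f.
    apply/setP => v; rewrite !covP; congr andb; apply: eq_existsb => w.
    rewrite ffunE; case: (w =P u) => [->|//]; rewrite fu; congr andb.
    by apply/eqP => -[E]; rewrite E eqxx in c'c.
  rewrite -mulrA -expRD; congr (_ * expR _).
  have -> : (S = \sum_(v in U) pending T (update f u c') v + #|G|)%N.
    rewrite /S -sum1_card [X in (_ + X)%N]big_mkcond /= [X in (_ + X)%N](bigID (mem U)) /=.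
    rewrite [X in (_ + (_ + X))%N]big1 ?addn0; last first.
      by move=> v /negPf vU; rewrite in_set vU.
    rewrite -big_split /=; apply: eq_bigr => v vU.
    rewrite /pending (cardsD1 u) [v \in G]in_set vU in_set fu eqxx andbT addnC /=.
    congr addn; apply: eq_card => w; rewrite !inE ffunE.
    by case: (w =P u) => [->|]; rewrite ?andbF.
  by rewrite -/U natrD; ring.
have hit : cover_potential p b B T c (update f u c)
      = (1 - p) ^+ #|covered B T c f| * expR (- (b * S%:R)) *
        ((1 - p) ^+ #|G| * expR (b * s%:R)).
  rewrite /cover_potential.
  have covE : covered B T c (update f u c) = covered B T c f :|: G.
    apply/setP => v; rewrite !inE.
    have [vB|] := boolP (v \in B); rewrite ?andbF //= andbT.
    have [/existsP[w /andP[wT /eqP fw]]|none] := boolP [exists w in T v, f w == Some c].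
      apply/existsP; exists w; rewrite wT ffunE fw.
      by case: (w =P u) => [E|]; rewrite ?eqxx.
    rewrite /=; apply/existsP/idP => [[w /andP[wT]]|uT]; last first.
      by exists u; rewrite uT ffunE !eqxx.
    rewrite ffunE; case: (w =P u) => [<- //|_ fw].
    by case/existsP: none; exists w; rewrite wT.
  have UE : U = (B :\: covered B T c (update f u c)) :|: G.
    apply/setP => v; rewrite covE in_setU !in_setD in_setU GP.
    by case: (v \in B); case: (v \in covered _ _ _ _); case: (u \in T v).
  have dis1 : [disjoint covered B T c f & G].
    rewrite -setI_eq0; apply/eqP/setP => v; rewrite in_setI GP in_set0.
    by case: (v \in covered _ _ _ _).
  have dis2 : [disjoint B :\: covered B T c (update f u c) & G].
    rewrite -setI_eq0 covE; apply/eqP/setP => v.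
    rewrite in_setI in_setD in_setU GP in_set0.
    by case: (v \in B); case: (v \in covered _ _ _ _); case: (u \in T v).
  (* A vertex that stays uncovered does not have [u] in [T v], so its pending count is unchanged. *)
  have SE : (S = \sum_(v in B :\: covered B T c (update f u c))
                    pending T (update f u c) v + s)%N.
    rewrite /S UE (eq_bigl _ _ (fun v => in_setU v _ _)) (bigU _ _ _ dis2) /=.
    congr addn; apply: eq_bigr => v.
    rewrite covE in_setD in_setU GP.
    case: (v \in covered _ _ _ _); case: (v \in B); rewrite ?andbF //= andbT => uT.
    apply: eq_card => w; rewrite !inE ffunE.
    by case: (w =P u) => [->|//]; rewrite (negPf uT).
  rewrite {1}covE cardsU (disjoint_setI0 dis1) cards0 subn0 exprD.
  set x := expR _; have -> : x = expR (- (b * S%:R)) * expR (b * s%:R).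
    by rewrite -expRD SE natrD; congr expR; ring.
  by rewrite mulrACA.
rewrite (bigD1 c) //= hit.
rewrite (eq_bigr (fun c' => P c' * ((1 - p) ^+ #|covered B T c f| *
  expR (- (b * S%:R)) * expR (b * #|G|%:R)))); last by move=> c' /miss ->.
rewrite -mulr_suml.
have -> : \sum_(c' | c' != c) P c' = 1 - P c.
  by move: P_sum1; rewrite (bigD1 c) //= => <-; rewrite [RHS]addrC addKr.
rewrite [leRHS]/cover_potential -/U -/S.
set Q := (1 - p) ^+ #|covered _ _ _ _| * _.
have Q0 : 0 <= Q by rewrite mulr_ge0 ?expR_ge0 ?exprn_ge0 // subr_ge0 (le_trans pP).
have sG : (s <= t * #|G|)%N.
  rewrite mulnC -sum_nat_const; apply: leq_sum => v; rewrite !inE => /andP[/andP[_ vB] _].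
  apply: leq_trans (T_card vB); apply/subset_leq_card/subsetP => w.
  by rewrite inE => /andP[].
have GD : #|G|%:R <= D.
  apply: le_trans (T_degree u); rewrite ler_nat.
  apply/subset_leq_card/subsetP => v; rewrite !inE.
  by case/andP => /andP[_ ->].
have := cover_balance p_gt0 pP P_le1 GD rate_le sG.
by rewrite -/b => /(ler_wpM2l Q0); rewrite mulr1; apply: le_trans; lra.
Qed.
End CoverStep.

(** * From potentials below 1 to a pseudocomplete colouring *)

(** On a complete colouring the exponent is zero, so the potential is either 0 or 1. *)
Lemma miss_potential_lt1 (R : realDomainType) (V C : finType) (p : R)
    (S : {set V}) (c : C) (g : {ffun V -> option C}) :
  (forall u, g u != None) -> miss_potential p S c g < 1 ->
  exists2 u, u \in S & g u = Some c.
Proof.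
move=> gN; rewrite /miss_potential; case: ifP => [/existsP[u /andP[uS /eqP gu]] _|_].
  by exists u.
rewrite (_ : [set u in S | _] = set0) ?cards0 ?ltxx //.
by apply/setP => u; rewrite !inE (negPf (gN u)) andbF.
Qed.

Lemma lt_sum_term (R : numDomainType) (I : finType) (Q : pred I) (F : I -> R) (i : I) (x : R) :
  (forall i, Q i -> 0 <= F i) -> Q i -> \sum_(i | Q i) F i < x -> F i < x.
Proof.
move=> F0 Qi; apply: le_lt_trans; rewrite (bigD1 i) //= lerDl.
by apply: sumr_ge0 => j /andP[Qj _]; apply: F0.
Qed.

Lemma average_sum (R : numDomainType) (I C : finType) (Q : pred I) (P : C -> R)
    (F : I -> C -> R) (G : I -> R) :
  (forall i, Q i -> \sum_c P c * F i c <= G i) ->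
  \sum_c P c * (\sum_(i | Q i) F i c) <= \sum_(i | Q i) G i.
Proof.
move=> FG; under eq_bigr do rewrite mulr_sumr.
by rewrite exchange_big; apply: ler_sum.
Qed.

Lemma average_add (R : numDomainType) (C : finType) (P F1 F2 : C -> R) (x y : R) :
  \sum_c P c * F1 c <= x -> \sum_c P c * F2 c <= y ->
  \sum_c P c * (F1 c + F2 c) <= x + y.
Proof.
move=> h1 h2; under eq_bigr do rewrite mulrDr.
by rewrite big_split; apply: lerD.
Qed.

(** [H] is coloured injectively, then [A] under [Phi1], then [B] under [Phi2]. The total starts
    below 1 and never grows, so finally no miss remains. The bounds on [D] are required only for
    [#|H| < d]: otherwise there is a single new colour and no pair of new colours to connect. *)
Lemma colouring_of_cut (R : realType) (V : finType) (e : rel V) (d t : nat)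
    (H A : {set V}) (T : V -> {set V}) (D eps : R) :
  let B := ~: H :\: A in
  let p0 : R := (2 * d.+1%:R)^-1 in
  let p : R := (2 * (d.+1 - #|H|)%:R)^-1 in
  symmetric e -> (0 < d)%N -> (#|H| <= d)%N -> A \subset ~: H ->
  (forall v, v \in B -> T v \subset [set w in A | e v w]) ->
  (forall v, v \in B -> #|T v| = t) ->
  (forall h, h \in H -> (1 - p0) ^+ #|[set w in ~: H | e h w]| <= eps) ->
  ((#|H| < d)%N -> [/\ forall u, #|[set v in B | u \in T v]|%:R <= D,
     cover_rate p D * t%:R <= p / 2 &
     expR (- (cover_rate p D * (t * #|B|)%:R)) <= eps]) ->
  0 <= D -> 0 <= eps -> 2 * d.+1%:R ^+ 2 * eps < 1 ->
  exists f : {ffun V -> 'I_d.+1}, pseudocomplete_colouring e f.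
Proof.
move=> B p0 p eC d0 Hd AH Te Tt Heps small D0 eps0 eps1.
pose b := cover_rate p D.
pose N h := [set w in ~: H | e h w].
pose col v : 'I_d.+1 := inord (index v (enum H)).
have col_inj : {in H &, injective col}.
  have lt x : x \in H -> (index x (enum H) < d.+1)%N.
    by move=> xH; rewrite ltnS ltnW // (leq_trans _ Hd) // cardE index_mem mem_enum.
  move=> x y xH yH /(congr1 val); rewrite /= !inordK ?lt // => /(congr1 (nth x (enum H))).
  by rewrite !nth_index ?mem_enum.
pose new := ~: (col @: H).
have new_card : #|new| = (d.+1 - #|H|)%N.
  apply/eqP; rewrite -(eqn_add2l #|H|) subnKC ?(leqW Hd) //.
  by rewrite -(card_in_imset col_inj) cardsC card_ord.
have k0 : (0 < d.+1 - #|H|)%N by rewrite subn_gt0 ltnS.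
have p0_gt0 : 0 < p0 by rewrite invr_gt0 mulr_gt0 // ltr0n.
have p_gt0 : 0 < p by rewrite invr_gt0 mulr_gt0 // ltr0n.
pose P c : R := p0 + (if c \in new then p else 0).
have P_ge0 c : 0 <= P c by rewrite addr_ge0 ?(ltW p0_gt0) //; case: ifP => // _; apply: ltW.
have P_sum1 : \sum_c P c = 1.
  rewrite big_split /= -big_mkcond /= !sumr_const card_ord new_card.
  rewrite -[p0 *+ _]mulr_natr -[p *+ _]mulr_natr /p0 /p !invfM.
  rewrite -!mulrA !mulVf ?pnatr_eq0 -?lt0n //; lra.
have p0P c : p0 <= P c by rewrite lerDl; case: ifP => // _; apply: ltW.
have pP c : c \in new -> p <= P c by move=> cn; rewrite /P cn lerDr ltW.
have P_le1 c : P c <= 1.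
  by rewrite -P_sum1 (bigD1 c) //= lerDl; apply: sumr_ge0.
have p0_le1 : p0 <= 1 := le_trans (p0P ord0) (P_le1 _).
have p_le1 : p <= 1.
  have /card_gt0P[c cn] : (0 < #|new|)%N by rewrite new_card.
  exact: le_trans (pP _ cn) (P_le1 _).
(* Pairs with an owned colour are left to [PhiH], which makes every vertex of [H] see all
   colours. *)
pose Q i j := [&& i \in new, j \in new & i != j].
have Qsmall i j : Q i j -> (#|H| < d)%N.
  case/and3P => ni nj ij; have: (1 < #|new|)%N.
    by apply/card_gt1P; exists i, j.
  by rewrite new_card ltn_subRL addn1 ltnS.
pose state := {ffun V -> option 'I_d.+1}.
pose PhiH (f : state) := \sum_(h in H) \sum_c miss_potential p0 (N h) c f.
(* The summand does not depend on [j]: one copy is reserved for each second colour, to be turned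
   into a miss potential in the next phase. *)
pose Phi1 (f : state) :=
  PhiH f + \sum_i \sum_(j | Q i j) cover_potential p b B T i f.
have PhiH_step (f : state) u : f u = None ->
    \sum_c P c * PhiH (update f u c) <= PhiH f.
  move=> fu; apply: average_sum => h hH; apply: average_sum => c _.
  exact: miss_potential_step.
pose f0 : state := [ffun v => if v \in H then Some (col v) else None].
have none0 v : v \notin H -> f0 v = None by move=> vH; rewrite ffunE (negPf vH).
(* Each of the two double sums has at most [d.+1 ^ 2] nonzero terms, each at most [eps]. *)
have Phi1_f0 : Phi1 f0 < 1.
  apply: le_lt_trans eps1; rewrite -mulrA mulr2n mulrDl mul1r.
  have sumC : \sum_(c < d.+1) eps = d.+1%:R * eps.
    by rewrite sumr_const card_ord mulr_natl.
  rewrite expr2 -mulrA; apply: lerD.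
    apply: (@le_trans _ _ (\sum_(h in H) d.+1%:R * eps)).
      apply: ler_sum => h hH; rewrite -sumC; apply: ler_sum => c _.
      rewrite /miss_potential; case: ifP => // _; apply: le_trans (Heps h hH).
      rewrite (_ : [set u in N h | f0 u == None] = N h) //.
      apply/setP => u; rewrite !inE; case: (boolP (u \in H)) => //= uH.
      by rewrite none0 // eqxx andbT.
    rewrite sumr_const -[leLHS]mulr_natl ler_wpM2r ?mulr_ge0 // ler_nat.
    exact: leq_trans Hd _.
  apply: (@le_trans _ _ (\sum_(i < d.+1) d.+1%:R * eps)).
    apply: ler_sum => i _; rewrite -sumC big_mkcond /=; apply: ler_sum => j _.
    case: ifP => // /Qsmall /small[_ _]; apply: le_trans.
    rewrite /cover_potential.
    (* At the start [A] is uncoloured, so nothing is covered and each vertex of [B] has all [t]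
       chances pending. *)
    have -> : covered B T i f0 = set0.
      apply/setP => v; rewrite !inE; apply/negP => /andP[/andP[vA vH]].
      case/existsP => u /andP[uT]; rewrite none0 //.
      have := subsetP (Te v _) u uT; rewrite !inE vA vH => /(_ isT) /andP[uA _].
      by have := subsetP AH u uA; rewrite inE.
    rewrite cards0 expr0 mul1r setD0 ler_expR lerN2 ler_wpM2l //.
      by rewrite /b /cover_rate divr_ge0 ?exprn_ge0 // ?addr_ge0 // ?mulr_ge0 ?(ltW p_gt0) //.
    rewrite ler_nat mulnC -sum_nat_const; apply: leq_sum => v vB.
    rewrite -(Tt v vB); apply/subset_leq_card/subsetP => u uT; rewrite inE uT /=.
    have := subsetP (Te v vB) u uT; rewrite inE => /andP[uA _].
    by rewrite none0 //; have := subsetP AH u uA; rewrite inE.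
  by rewrite sumr_const card_ord -[leLHS]mulr_natl.
have [f u uA fu|g1 [g1A g1o g1_le]] := derandomize (A := A) (Phi := Phi1) P_ge0 P_sum1 _ f0.
  apply: average_add; first exact: PhiH_step.
  apply: average_sum => i _; apply: average_sum => j Qij.
  have [TD rt _] := small (Qsmall _ _ Qij).
  apply: (@cover_potential_step _ _ _ P p D B T t) => //.
    by apply: pP; case/and3P: Qij.
  by move=> v /Tt ->.
have B_H v : v \in B -> v \notin H by rewrite !inE => /andP[].
have B_A v : v \in B -> v \notin A by rewrite !inE => /andP[].
have g1B v : v \in B -> g1 v = None.
  by move=> vB; rewrite g1o ?none0 ?B_H ?B_A.
pose Phi2 (f : state) :=
  PhiH f + \sum_i \sum_(j | Q i j) miss_potential p (covered B T i g1) j f.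
(* Handover: with [A] coloured no chance is pending, and [(1 - p) ^+ #|covered|] bounds the miss
   potential of the covered set, still uncoloured in [B]. *)
have Phi2_g1 : Phi2 g1 < 1.
  apply: le_lt_trans (le_lt_trans g1_le Phi1_f0); rewrite lerD2l.
  apply: ler_sum => i _; apply: ler_sum => j _.
  rewrite /miss_potential; case: ifP => _.
    by rewrite mulr_ge0 ?expR_ge0 // exprn_ge0 // subr_ge0.
  rewrite /cover_potential [X in _ * X](_ : _ = 1) ?mulr1; last first.
    rewrite big1 ?mulr0 ?oppr0 ?expR0 // => v; rewrite inE => /andP[_ vB].
    apply/eqP; rewrite cards_eq0; apply/eqP/setP => u; rewrite !inE.
    apply/negP => /andP[uT]; apply/negP/g1A.
    by have := subsetP (Te v vB) u uT; rewrite inE => /andP[].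
  rewrite (_ : [set u in covered B T i g1 | g1 u == None] = covered B T i g1) //.
  apply/setP => v; rewrite in_set andb_idr // => vc.
  by rewrite g1B //; move: vc; rewrite in_set => /andP[].
have [f u uB fu|g [gB go g_le]] := derandomize (A := B) (Phi := Phi2) P_ge0 P_sum1 _ g1.
  apply: average_add; first exact: PhiH_step.
  apply: average_sum => i _; apply: average_sum => j Qij.
  by apply: miss_potential_step => //; apply: pP; case/and3P: Qij.
have g_lt1 := le_lt_trans g_le Phi2_g1.
have PhiH_ge0 : 0 <= PhiH g.
  by apply: sumr_ge0 => h _; apply: sumr_ge0 => c _; apply: miss_potential_ge0.
have PhiN_ge0 : 0 <= \sum_i \sum_(j | Q i j) miss_potential p (covered B T i g1) j g.
  by apply: sumr_ge0 => h _; apply: sumr_ge0 => c _; apply: miss_potential_ge0.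
have gH v : v \in H -> g v = Some (col v).
  move=> vH; have vA : v \notin A by apply: contraL vH => /(subsetP AH); rewrite inE.
  by rewrite go ?g1o ?vA // ?ffunE ?vH // in_setD inE vH andbF.
have gN v : g v != None.
  have [vH|vH] := boolP (v \in H); first by rewrite gH.
  have [vA|vA] := boolP (v \in A); last by apply: gB; rewrite !inE vA.
  by rewrite go ?g1A // in_setD vA.
have old h c : h \in H -> exists2 u, e h u & g u = Some c.
  move=> hH; have lt : PhiH g < 1 by apply: le_lt_trans g_lt1; rewrite lerDl.
  have {}lt : \sum_c miss_potential p0 (N h) c g < 1.
    apply: lt_sum_term hH lt => h' _.
    by apply: sumr_ge0 => c' _; apply: miss_potential_ge0.
  have {}lt : miss_potential p0 (N h) c g < 1.
    by apply: lt_sum_term (erefl true) lt => c' _; apply: miss_potential_ge0.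
  have [u uN gu] := miss_potential_lt1 gN lt; exists u => //.
  by move: uN; rewrite inE => /andP[].
have pair i j : i != j -> exists u v, [/\ e u v, g u = Some i & g v = Some j].
  move=> ij; have [/imsetP[h hH ->]|ni] := boolP (i \in col @: H).
    by have [u eu gu] := old h j hH; exists h, u; split; [ | rewrite gH | ].
  have [/imsetP[h hH ->]|nj] := boolP (j \in col @: H).
    by have [u eu gu] := old h i hH; exists u, h; split; [rewrite eC | | rewrite gH].
  have Qij : Q i j by rewrite /Q !inE ni nj.
  have lt : \sum_i \sum_(j | Q i j) miss_potential p (covered B T i g1) j g < 1.
    by apply: le_lt_trans g_lt1; rewrite lerDr.
  have {}lt : \sum_(j | Q i j) miss_potential p (covered B T i g1) j g < 1.
    apply: (lt_sum_term (i := i)) lt => // i' _.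
    by apply: sumr_ge0 => c' _; apply: miss_potential_ge0.
  have {}lt : miss_potential p (covered B T i g1) j g < 1.
    by apply: lt_sum_term Qij lt => c' _; apply: miss_potential_ge0.
  (* A vertex [v] covered for [i] that receives [j] forms the required edge with a kept neighbour
     coloured [i]. *)
  have [v + gv] := miss_potential_lt1 gN lt.
  rewrite in_set => /andP[vB /existsP[u /andP[uT /eqP gu]]].
  have := subsetP (Te v vB) u uT; rewrite inE => /andP[uA euv].
  by exists u, v; split; rewrite 1?eC // go ?gu // in_setD uA.
exists [ffun v => odflt ord0 (g v)]; apply/andP; split; apply/forallP => i.
  (* As [d > 0], each colour has a partner, and an edge for the pair shows that the colour is
     used. *)
  have [j ij] : exists j : 'I_d.+1, i != j.
    case: (altP (i =P ord0)) => [->|]; last by exists ord0.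
    by exists ord_max; rewrite -val_eqE /= eq_sym -lt0n.
  have [u [v [_ gu _]]] := pair i j ij.
  by apply/existsP; exists u; rewrite ffunE gu.
apply/forallP => j; apply/implyP => ij; have [u [v [euv gu gv]]] := pair i j ij.
by apply/existsP; exists u; apply/existsP; exists v; rewrite !ffunE euv gu gv !eqxx.
Qed.

(** * Numerical estimates and choice of parameters *)

(** The rate is [1 / q] with [q = 8 k^2 + 32 k d l <= 48 d l k], so [t * m >= 144 d l^2 k] suffices;
    the hypotheses give [t * m >= k * n / 16 >= 250 d l^2 k]. *)
Lemma cover_exponent_ge (R : realType) (l n : R) (d k t m : nat) :
  1 <= l -> (0 < k)%N -> (k <= 2 * d)%N -> (k <= 4 * t)%N -> n <= 4 * m%:R ->
  4000 * d%:R * l ^+ 2 <= n ->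
  3 * l <= cover_rate (2 * k%:R)^-1 (16 * d%:R * l) * (t * m)%:R.
Proof.
move=> l1 k0 kd kt nm dn; rewrite natrM.
have {}k0 : 0 < k%:R :> R by rewrite ltr0n.
have {}kd : k%:R <= 2 * d%:R :> R by rewrite -natrM ler_nat.
have {}kt : k%:R <= 4 * t%:R :> R by rewrite -natrM ler_nat.
have l0 : 0 <= l by lra.
move: k%:R t%:R m%:R d%:R k0 kd kt nm dn (ler0n R m) (ler0n R d) (ler0n R t).
move=> {}k {}t {}m {}d k0 kd kt nm dn m0 d0 t0.
have dl0 : 0 <= d * l by rewrite mulr_ge0.
have dldl : d <= d * l by rewrite ler_peMr.
pose q := 8 * k ^+ 2 + 2 * k * (16 * d * l).
have kdl0 : 0 <= k * (d * l) by rewrite mulr_ge0 // ltW.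
have kk0 : 0 < k * k by rewrite mulr_gt0.
have q0 : 0 < q by rewrite /q; nra.
have -> : cover_rate (2 * k)^-1 (16 * d * l) = q^-1.
  rewrite /cover_rate /q; field; rewrite !gt_eqF //; nra.
rewrite [leRHS]mulrC ler_pdivlMr //.
have q_le : q <= 48 * (d * l) * k.
  have : k * k <= 2 * d * k by rewrite ler_wpM2r // ltW.
  have : d * k <= d * l * k by rewrite ler_wpM2r // ltW.
  rewrite /q expr2; lra.
apply: (@le_trans _ _ (3 * l * (48 * (d * l) * k))).
  by rewrite ler_wpM2l // mulr_ge0.
have h1 : 4000 * d * l ^+ 2 * k <= 4 * m * k by rewrite ler_wpM2r ?(le_trans dn) // ltW.
have h2 : m * k <= m * (4 * t) by rewrite ler_wpM2l.
have tm0 : 0 <= t * m by rewrite mulr_ge0.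
move: h1; rewrite !expr2; lra.
Qed.

Lemma min_degree_le (V : finType) (e : rel V) (v : V) :
  (min_degree e <= degree e v)%N.
Proof.
rewrite /min_degree; have := mem_index_enum v; elim: (index_enum V) => //= w r IH.
rewrite inE big_cons => /orP[/eqP <-|/IH]; first exact: geq_minl.
by apply: leq_trans; apply: geq_minr.
Qed.

Lemma degree_setC (V : finType) (e : rel V) (H : {set V}) (v : V) :
  (degree e v <= #|H| + #|[set w in ~: H | e v w]|)%N.
Proof.
rewrite /degree -(cardsID H) leq_add ?subset_leq_card ?subsetIr //.
by apply/subsetP => w; rewrite !inE.
Qed.

(** Here [l] is the logarithm of the order [n], the degree threshold is [D = 16 d l], and
    [eps = expR (- (3 * l))] is [n^-3]. *)
Lemma pseudocomplete_colouring_exists (R : realType) (V : finType) (e : rel V)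
    (d : nat) (l : R) :
  symmetric e -> irreflexive e -> (0 < d)%N -> (d <= min_degree e)%N ->
  1 <= l -> #|V|%:R = expR l -> 4000 * d%:R * l ^+ 2 <= #|V|%:R ->
  exists f : {ffun V -> 'I_d.+1}, pseudocomplete_colouring e f.
Proof.
move=> eC eI d0 dmin l1 nl dn; pose n : R := #|V|%:R.
pose D : R := 16 * d%:R * l; pose high := [set v | D <= (degree e v)%:R].
have d1 : 1 <= d%:R :> R by rewrite ler1n.
have dl1 : d%:R <= d%:R * l by rewrite ler_peMr.
have dl2 : d%:R * l <= d%:R * l ^+ 2.
  by rewrite expr2 ler_wpM2l // ler_peMr //; lra.
have n4 : 4000 * d%:R <= n by apply: le_trans dn; rewrite -mulrA ler_wpM2l //; lra.
have [H Hhigh Hcard] := exists_subset_card (geq_minr d #|high|).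
have Hd : (#|H| <= d)%N by rewrite Hcard geq_minl.
have [A [AH BW Bdeg]] := majority_cut (~: H) eC eI.
(* A vertex of [B] has at least [d - #|H| = k - 1] neighbours outside [H], at least half of them in
   [A]; [T] keeps exactly [t] of these. *)
pose B := ~: H :\: A; pose k := (d.+1 - #|H|)%N; pose t := uphalf (d - #|H|).
have [T TP] : exists T : V -> {set V}, forall v, v \in B ->
    T v \subset [set w in A | e v w] /\ #|T v| = t.
  apply: (fin_all_exists (U := fun=> {set V}) (P := fun v X => v \in B ->
      X \subset [set w in A | e v w] /\ #|X| = t)) => v.
  have [vB|_] := boolP (v \in B); last by exists set0.
  have [|X X1 X2] := @exists_subset_card _ [set w in A | e v w] t; last by exists X.
  rewrite /t leq_uphalf_double -mul2n (leq_trans _ (Bdeg _ vB)) // leq_subLR.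
  exact: leq_trans dmin (leq_trans (min_degree_le e v) (degree_setC e H v)).
have n0 : 0 < n by lra.
apply: (@colouring_of_cut R V e d t H A T D (expR (- (3 * l)))) => //.
- by move=> v /TP[].
- by move=> v /TP[].
- move=> h hH; set m := #|_|; set p0 := _^-1.
  have p01 : p0 <= 1 by rewrite invf_le1 ?mulr_gt0 // -natrM ler1n.
  apply: le_trans (expr_le_expR m p01) _; rewrite ler_expR lerN2.
  (* At most [d <= d * l] of the neighbours lie in [H]. Since [d + 1 <= 2 d], the remaining [15 d l]
     exceed the [6 (d + 1) l] required by [p0]. *)
  have mD : 15 * (d%:R * l) <= m%:R.
    have : D <= d%:R + m%:R.
      have := subsetP Hhigh h hH; rewrite inE => /le_trans; apply.
      by rewrite -natrD ler_nat (leq_trans (degree_setC e H h)) // leq_add2r.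
    rewrite /D; lra.
  rewrite [leRHS]mulrC /p0 ler_pdivlMr; last by rewrite mulr_gt0.
  rewrite -natr1; nra.
(* When [#|H| < d], all high vertices were taken, so vertices outside [H] have degree below [D]. *)
- move=> Hlt; have Hhi : H = high.
    move: Hlt; rewrite Hcard gtn_min ltnn /= => /ltnW hd.
    by apply/eqP; rewrite eqEcard Hhigh Hcard (minn_idPr hd) leqnn.
  have k0 : (0 < k)%N by rewrite subn_gt0 ltnS.
  have kE : k = (d - #|H|).+1 by rewrite /k subSn.
  have dH : (0 < d - #|H|)%N by rewrite subn_gt0.
  have tk : (t <= k)%N by rewrite leq_uphalf_double -addnn kE addSn leqW ?leq_addr.
  have kt : (k <= 4 * t)%N.
    have at2 : (d - #|H| <= 2 * t)%N by rewrite mul2n -leq_uphalf_double.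
    rewrite kE -add1n (leq_trans (leq_add dH at2)) //.
    by rewrite -[4%N]/(2 + 2)%N mulnDl leq_add2r.
  have k2d : (k <= 2 * d)%N.
    by rewrite (leq_trans (leq_subr _ _)) // mul2n -addnn -add1n leq_add2r.
  split=> [u||].
  + have [->|[v]] := set_0Vmem [set v in B | u \in T v].
      by rewrite cards0 /D !mulr_ge0 //; lra.
    rewrite inE => /andP[vB uT].
    have uA : u \in A by have := subsetP (TP v vB).1 u uT; rewrite inE => /andP[].
    have : u \notin high by rewrite -Hhi; have := subsetP AH u uA; rewrite inE.
    rewrite inE -ltNge => /ltW; apply: le_trans; rewrite ler_nat.
    apply/subset_leq_card/subsetP => w; rewrite in_set => /andP[wB uw]; rewrite in_set eC.
    by have := subsetP (TP w wB).1 u uw; rewrite inE => /andP[].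
  (* From [t <= k] comes [p * t <= 1], while the denominator of the rate is at least 2. *)
  + rewrite -/k; set p := _^-1.
    have p0 : 0 < p by rewrite invr_gt0 mulr_gt0 // ltr0n.
    have pt : p * t%:R <= 1.
      rewrite mulrC /p ler_pdivrMr ?mul1r; last by rewrite mulr_gt0 // ltr0n.
      by rewrite -natrM ler_nat (leq_trans tk) // leq_pmull.
    have pD : 0 <= p * D by rewrite /D !mulr_ge0 //; lra.
    rewrite /cover_rate mulrAC ler_pdivrMr; last lra.
    have : p * (p * t%:R) <= p * 1 by rewrite ler_wpM2l // ltW.
    have : 0 <= p * (p * D) by rewrite mulr_ge0 // ltW.
    rewrite expr2; lra.
  + rewrite ler_expR lerN2; apply: (@cover_exponent_ge R l n) => //.
    have : n - d%:R <= 2 * #|B|%:R.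
      rewrite lerBlDl -natrM -natrD ler_nat (leq_trans _ (leq_add Hd BW)) //.
      by rewrite cardsC.
    lra.
- by rewrite /D !mulr_ge0 //; lra.
- exact: expR_ge0.
- have -> : - (3 * l) = - (l * 3%:R) by rewrite mulrC.
  rewrite expRN expRM_natr -nl -/n ltr_pdivrMr ?exprn_gt0 // mul1r.
  (* This gives [2 (d + 1)^2 <= n^2 / 2 < n^3]. *)
  have dn' : d.+1%:R <= n / 2 by rewrite -natr1; lra.
  apply: (@le_lt_trans _ _ (2 * (n / 2) ^+ 2)).
    by rewrite ler_wpM2l // lerXn2r ?nnegrE // ltW // divr_gt0.
  have : 0 < n ^+ 2 by rewrite exprn_gt0.
  rewrite exprS; nra.
Qed.

Theorem theorem1p3 (R : realType) :
  exists (c : R) (n0 : nat), [/\ 0 < c, (2 <= n0)%N &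
    forall n d : nat, (n0 <= n)%N -> (1 <= d)%N ->
      d%:R <= c * n%:R / (ln n%:R) ^+ 2 ->
    forall (V : finType) (e : rel V), symmetric e -> irreflexive e ->
      #|V| = n -> (d <= min_degree e)%N ->
      (d + 1 <= pseudoachromatic_number e)%N].
Proof.
(* One successor puts [n0] above [expR 1], so that [ln n >= 1]; the second makes [2 <= n0]
   immediate. *)
exists 4000^-1, (Num.truncn (expR 1 : R)).+2; split=> // [|n d n0 d1 dn V e eC eI Vn dmin].
  by rewrite invr_gt0.
have n_gt0 : 0 < n%:R :> R by rewrite ltr0n; apply: leq_trans n0.
have l1 : 1 <= ln (n%:R : R).
  rewrite -[leLHS](expRK 1) ler_ln ?posrE ?expR_gt0 // ltW //.
  apply: lt_le_trans (truncnS_gt _) _; rewrite ler_nat.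
  exact: leq_trans (leqnSn _) n0.
rewrite addn1; have [||f fP] := @pseudocomplete_colouring_exists R V e d (ln n%:R) eC eI d1 dmin l1.
- by rewrite Vn lnK.
- have l0 : 0 < ln (n%:R : R) ^+ 2 by rewrite exprn_gt0 //; lra.
  by move: dn; rewrite Vn ler_pdivlMr //; lra.
exact: leq_pseudoachromatic_number fP.
Qed.
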